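(* Let $P$ be a reversible ergodic random walk on a finite state space $X$, and let $\mathcal{M}\subset X$ be a non-empty subset of marked elements. The extended hitting time on $\mathcal{M}$ is in the order of (at most a universal constant times) the maximum of the hitting times of its members: $$\mathrm{HT}^{+}(P,\mathcal{M})\in O\left(\max_{m\in\mathcal{M}}\mathrm{HT}(P,\{m\})\right).$$
   Context: A random walk on a finite set $X$ of size $N$ is a column-stochastic matrix $P$, with $P_{yx}$ the probability of moving from $x$ to $y$. It is ergodic if its underlying directed graph is strongly connected and aperiodic; then it has a unique stationary distribution $\pi$, with all entries positive. It is reversible if $P_{yx}\pi_x=P_{xy}\pi_y$ for all $x,y$. Write $|\pi\rangle=\sum_{x\in X}\sqrt{\pi_x}\,|x\rangle$. For a marked set $\mathcal{M}$, the absorbing walk $P'$ has $P'_{xx}=1$ and $P'_{yx}=0$ for $y\ne x$ if $x\in\mathcal{M}$, and $P'_{yx}=P_{yx}$ for all $y$ if $x\notin\mathcal{M}$. The hitting time $\mathrm{HT}(P,\mathcal{M})$ is the expected number of steps the walk takes to reach a marked state, when it starts in a state drawn from $\pi$ and halts as soon as it is in a marked state. The interpolated walk is $P(s)=(1-s)P+sP'$ for $0\le s<1$. The discriminant of a walk $Q$ is the real symmetric matrix $D(Q)=\sqrt{Q\circ Q^{T}}$ (entrywise product and entrywise square root). For $0\le s<1$ let $\lambda_1(s)=1>\lambda_2(s)\ge\dots\ge\lambda_N(s)$ be the eigenvalues of $D(P(s))$ with orthonormal eigenvectors $|\lambda_k(s)\rangle$. The extended hitting time is the limit $$\mathrm{HT}^{+}(P,\mathcal{M})=\lim_{s\to1^-}\sum_{k=2}^{N}\frac{|\langle\lambda_k(s)|\pi\rangle|^2}{1-\lambda_k(s)}.$$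 *)

(* Defs.v *)
From HB Require Import structures.
From mathcomp Require Import all_boot all_order all_algebra.
From mathcomp Require Import all_classical all_reals all_analysis.

Set Implicit Arguments.
Unset Strict Implicit.
Unset Printing Implicit Defensive.

Import Order.TTheory GRing.Theory Num.Theory.
Import numFieldNormedType.Exports.

Local Open Scope ring_scope.
Local Open Scope classical_set_scope.

(* The state space is 'I_N. Walks are column-stochastic: [P y x] is the
   probability of moving from [x] to [y]. *)

Definition random_walk (R : realType) (N : nat) (P : 'M[R]_N) : Prop :=
  (forall y x, 0 <= P y x) /\ (forall x, \sum_y P y x = 1).

Definition walk_edge (R : realType) (N : nat) (P : 'M[R]_N) : rel 'I_N :=
  fun x y => 0 < P y x.

Definition strongly_connected (T : finType) (e : rel T) : Prop :=
  forall x y, connect e x y.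

(* The gcd of the lengths of all closed walks is 1; [cycle] allows repeated
   vertices, and the empty cycle has length 0 and imposes nothing. *)
Definition aperiodic (T : finType) (e : rel T) : Prop :=
  forall d : nat, (forall c : seq T, cycle e c -> (d %| size c)%N) -> d = 1%N.

Definition ergodic (R : realType) (N : nat) (P : 'M[R]_N) : Prop :=
  strongly_connected (walk_edge P) /\ aperiodic (walk_edge P).

Definition stationary (R : realType) (N : nat) (P : 'M[R]_N) (pi : 'cV[R]_N)
    : Prop :=
  [/\ forall x, 0 <= pi x 0, \sum_x pi x 0 = 1 & P *m pi = pi].

Definition reversible (R : realType) (N : nat) (P : 'M[R]_N) (pi : 'cV[R]_N)
    : Prop :=
  forall x y, P y x * pi x 0 = P x y * pi y 0.

Definition absorbing_walk (R : realType) (N : nat) (P : 'M[R]_N)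
    (M : {set 'I_N}) : 'M[R]_N :=
  \matrix_(y, x) if x \in M then (y == x)%:R else P y x.

Definition interpolated_walk (R : realType) (N : nat) (P : 'M[R]_N)
    (M : {set 'I_N}) (s : R) : 'M[R]_N :=
  (1 - s) *: P + s *: absorbing_walk P M.

Definition discriminant (R : realType) (N : nat) (Q : 'M[R]_N) : 'M[R]_N :=
  \matrix_(x, y) Num.sqrt (Q x y * Q y x).

(* Probability that the walk started from [pi] follows the trajectory
   [w 0], ..., [w t]. *)
Definition trajectory_prob (R : realType) (N : nat) (P : 'M[R]_N)
    (pi : 'cV[R]_N) (t : nat) (w : {ffun 'I_t.+1 -> 'I_N}) : R :=
  pi (w ord0) 0 *
  \prod_(i < t) P (w (lift ord0 i)) (w (widen_ord (leqnSn t) i)).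

(* Probability that the walk is in [M] for the first time at time [t]. *)
Definition first_hit_prob (R : realType) (N : nat) (P : 'M[R]_N)
    (pi : 'cV[R]_N) (M : {set 'I_N}) (t : nat) : R :=
  \sum_(w : {ffun 'I_t.+1 -> 'I_N} |
        (w ord_max \in M) && [forall i : 'I_t.+1, (i < t)%N ==> (w i \notin M)])
    trajectory_prob P pi w.

(* Expectation of the hitting time, an extended natural number: the last term
   accounts for the event that [M] is never reached (recall 0 * +oo = 0). *)
Definition hitting_time (R : realType) (N : nat) (P : 'M[R]_N)
    (pi : 'cV[R]_N) (M : {set 'I_N}) : \bar R :=
  (\sum_(0 <= t <oo) (t%:R * first_hit_prob P pi M t)%:E +
   (1 - \sum_(0 <= t <oo) (first_hit_prob P pi M t)%:E) * +oo)%E.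

Definition dotcol (R : realType) (N : nat) (u v : 'cV[R]_N) : R :=
  \sum_x u x 0 * v x 0.

Definition sqrt_state (R : realType) (N : nat) (pi : 'cV[R]_N) : 'cV[R]_N :=
  \col_x Num.sqrt (pi x 0).

(* [lam] lists all eigenvalues of [A], with multiplicity, in nonincreasing
   order. *)
Definition ordered_eigenbasis (R : realType) (N : nat) (A : 'M[R]_N)
    (lam : 'I_N -> R) (psi : 'I_N -> 'cV[R]_N) : Prop :=
  [/\ forall j k, dotcol (psi j) (psi k) = (j == k)%:R,
      forall k, A *m psi k = lam k *: psi k &
      forall j k : 'I_N, (j <= k)%N -> lam k <= lam j].

(* Indices start at 0, so index 0 carries the top eigenvalue. *)
Definition spectral_sum (R : realType) (N : nat) (pi : 'cV[R]_N)
    (lam : 'I_N -> R) (psi : 'I_N -> 'cV[R]_N) : R :=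
  \sum_(k < N | (0 < k)%N) `|dotcol (psi k) (sqrt_state pi)| ^+ 2 / (1 - lam k).

(* The limit exists and equals [h], for every choice of the eigenbases; such
   eigenbases exist since discriminants are real symmetric matrices. *)
Definition is_extended_hitting_time (R : realType) (N : nat) (P : 'M[R]_N)
    (pi : 'cV[R]_N) (M : {set 'I_N}) (h : R) : Prop :=
  forall (lam : R -> 'I_N -> R) (psi : R -> 'I_N -> 'cV[R]_N),
    (forall s, 0 <= s < 1 ->
       ordered_eigenbasis (discriminant (interpolated_walk P M s))
         (lam s) (psi s)) ->
    spectral_sum pi (lam s) (psi s) @[s --> 1^'-] --> h.

(* Main.v *)
Require Import Defs.
From HB Require Import structures.
From mathcomp Require Import all_boot all_order all_algebra.
From mathcomp Require Import all_classical all_reals all_analysis.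
From mathcomp Require Import ring lra.
Import Order.TTheory GRing.Theory Num.Theory.
Import numFieldNormedType.Exports.
Local Open Scope ring_scope.

(* Conjugating [1 - D(P(s))] by the square root of the stationary distribution
   of [P(s)] gives [1 - s] times the Laplacian [L] of [P]. Hence the spectral
   sum is an explicit factor, tending to 1, times the energy of the potential
   [f] with [L f = pi - pi|M], where [pi|M] is [pi] conditioned on [M]. As
   [pi|M] is a convex combination of point masses, convexity of the energy
   bounds it by the energy of some [h_m] with [L h_m = pi - delta_m], m in [M].
   Stopping [h_m] along the walk killed at [m] shows that this energy is at
   most twice a partial sum of the survival probabilities, which is itself a
   lower bound of the hitting time of [m]. *)

(** * The Laplacian of a reversible walk and its Poisson equation *)

Section Laplacian.
Context {R : realType} {N : nat}.
Variables (P : 'M[R]_N) (pi : 'cV[R]_N).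

(** The factor [pi x 0] makes the operator symmetric when the walk is reversible. *)
Definition laplacian (f : 'I_N -> R) (x : 'I_N) : R :=
  pi x 0 * (f x - \sum_y P y x * f y).

Definition dirichlet (f k : 'I_N -> R) : R := \sum_x k x * laplacian f x.

Hypothesis walkP : random_walk P.
Hypothesis revP : reversible P pi.
Hypothesis statP : stationary P pi.

Lemma laplacianE f x :
  laplacian f x = pi x 0 * f x - \sum_y pi y 0 * P x y * f y.
Proof.
rewrite /laplacian mulrBr mulr_sumr; congr (_ - _); apply: eq_bigr => y _.
by rewrite mulrA [_ * P y x]mulrC revP (mulrC (P x y)).
Qed.

Lemma sum_laplacian f : \sum_x laplacian f x = 0.
Proof.
under eq_bigr do rewrite laplacianE.
rewrite big_split /= sumrN exchange_big /=.
apply/eqP; rewrite subr_eq0; apply/eqP/eq_bigr => y _.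
under [RHS]eq_bigr do rewrite mulrAC.
by rewrite -mulr_sumr (walkP.2 y) mulr1.
Qed.

Lemma laplacian_lin (a : R) f k x :
  laplacian (fun y => a * f y + k y) x = a * laplacian f x + laplacian k x.
Proof.
rewrite /laplacian; under eq_bigr do rewrite mulrDr mulrCA.
rewrite big_split /= -mulr_sumr; ring.
Qed.

Lemma dirichletC f k : dirichlet f k = dirichlet k f.
Proof.
rewrite /dirichlet; under eq_bigr do rewrite laplacianE mulrBr mulr_sumr.
under [RHS]eq_bigr do rewrite /laplacian mulrBr mulrBr !mulr_sumr.
rewrite !big_split /= !sumrN; congr (_ - _).
  by apply: eq_bigr => x _; ring.
by rewrite exchange_big /=; apply: eq_bigr => x _; apply: eq_bigr => y _; ring.
Qed.

(** Expand the square: both pure terms equal the [pi]-mean of [f ^+ 2], one by the column sums of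
    [P], the other by detailed balance. *)
Lemma dirichletE f :
  dirichlet f f = 2^-1 * \sum_x \sum_y pi x 0 * P y x * (f x - f y) ^+ 2.
Proof.
have s1 : \sum_x \sum_y pi x 0 * P y x * f x ^+ 2 = \sum_x pi x 0 * f x ^+ 2.
  apply: eq_bigr => x _; under eq_bigr do rewrite mulrAC.
  by rewrite -mulr_sumr (walkP.2 x) mulr1.
have s2 : \sum_x \sum_y pi x 0 * P y x * f y ^+ 2 = \sum_x pi x 0 * f x ^+ 2.
  rewrite -s1 exchange_big; apply: eq_bigr => x _; apply: eq_bigr => y _.
  by rewrite (mulrC _ (P x y)) -revP (mulrC (P y x)).
have -> : \sum_x \sum_y pi x 0 * P y x * (f x - f y) ^+ 2 =
  \sum_x pi x 0 * f x ^+ 2 + \sum_x pi x 0 * f x ^+ 2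
  - 2 * \sum_x \sum_y pi x 0 * P y x * (f x * f y).
  rewrite -{1}s1 -{1}s2 -big_split mulr_sumr -sumrB; apply: eq_bigr => x _.
  rewrite -big_split mulr_sumr -sumrB; apply: eq_bigr => y _ /=; ring.
have -> : dirichlet f f = \sum_x pi x 0 * f x ^+ 2
   - \sum_x \sum_y pi x 0 * P y x * (f x * f y).
  rewrite -sumrB; apply: eq_bigr => x _; rewrite /laplacian.
  rewrite !mulrBr !mulr_sumr; congr (_ - _); first by ring.
  by apply: eq_bigr => y _; ring.
by field.
Qed.

Lemma dirichlet_ge0 f : 0 <= dirichlet f f.
Proof.
have [pi0 _ _] := statP.
rewrite dirichletE mulr_ge0 ?invr_ge0//; apply: sumr_ge0 => x _.
apply: sumr_ge0 => y _; rewrite mulr_ge0 ?sqr_ge0// mulr_ge0//.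
exact: walkP.1.
Qed.

(** Expands the nonnegative energy of [k - f]; this is the convexity used at the end. *)
Lemma dirichlet_cross_le f k : 2 * dirichlet f k <= dirichlet f f + dirichlet k k.
Proof.
have := dirichlet_ge0 (fun y => -1 * f y + k y).
suff -> : dirichlet (fun y => -1 * f y + k y) (fun y => -1 * f y + k y) =
  dirichlet f f + dirichlet k k - 2 * dirichlet f k by rewrite subr_ge0.
have -> : 2 * dirichlet f k = dirichlet f k + dirichlet k f.
  by rewrite (dirichletC k); ring.
rewrite /dirichlet -!big_split /= -sumrB; apply: eq_bigr => x _.
rewrite laplacian_lin; ring.
Qed.

Hypothesis connP : strongly_connected (walk_edge P).

(** Some state has positive mass, and detailed balance carries positivity along every edge. *)
Lemma stationary_gt0 x : 0 < pi x 0.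
Proof.
have [pi0 pi1 _] := statP.
have [y y0] : exists y, 0 < pi y 0.
  apply: contrapT => h; move: pi1; rewrite big1 => [/eqP|y _].
    by rewrite eq_sym oner_eq0.
  apply/eqP; apply/negPn/negP => yn; apply: h; exists y.
  by rewrite lt_neqAle eq_sym yn pi0.
have /connectP[p] := connP y x.
elim: p y y0 => [y y0 _ ->//|z p IH y y0 /= /andP[yz] pz].
apply: IH => //; have h : 0 < P y z * pi z 0 by rewrite -revP mulr_gt0.
rewrite lt_neqAle pi0 andbT; apply/eqP => z0.
by move: h; rewrite -z0 mulr0 ltxx.
Qed.

(** Every edge term of [dirichletE] vanishes, so [f] is constant along paths. *)
Lemma dirichlet_eq0 f x y : dirichlet f f = 0 -> f x = f y.
Proof.
move=> /eqP; rewrite dirichletE mulf_eq0 invr_eq0 pnatr_eq0 /= => h.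
have pos a b : 0 <= pi a 0 * P b a * (f a - f b) ^+ 2.
  by rewrite mulr_ge0 ?sqr_ge0// mulr_ge0// ?(ltW (stationary_gt0 _))// walkP.1.
have edge a b : walk_edge P a b -> f a = f b.
  move=> ab; move: h; rewrite psumr_eq0; last by move=> c _; apply: sumr_ge0.
  move=> /allP/(_ a (mem_index_enum _)) /=; rewrite psumr_eq0//.
  move=> /allP/(_ b (mem_index_enum _)) /=.
  rewrite !mulf_eq0 (gt_eqF (stationary_gt0 a)) (gt_eqF ab) /= orbb subr_eq0.
  by move=> /eqP.
have /connectP[p] := connP x y.
by elim: p x => [x _ ->//|z p IH x /= /andP[/edge -> pz]]; apply: IH.
Qed.

(* Adding the all-ones matrix makes the Laplacian invertible without changing
   it on functions of sum zero. *)
Lemma poisson (g : 'I_N -> R) :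
  \sum_x g x = 0 -> exists f, forall x, laplacian f x = g x.
Proof.
move=> g0; pose A := \matrix_(x, y) (pi x 0 * (x == y)%:R - pi y 0 * P x y + 1).
have AE (v : 'cV[R]_N) x :
    (A *m v) x 0 = laplacian (fun y => v y 0) x + \sum_y v y 0.
  rewrite mxE laplacianE; under eq_bigr do rewrite mxE mulrDl mul1r mulrBl.
  rewrite !big_split /= sumrN; congr (_ - _ + _).
  rewrite (bigD1 x)//= eqxx mulr1 big1 ?addr0// => y yx.
  by rewrite eq_sym (negbTE yx) mulr0 mul0r.
(* The index [i] serves as a witness that [N] is positive. *)
have sum_cst_eq0 (i : 'I_N) (c : R) : \sum_(x < N) c = 0 -> c = 0.
  rewrite sumr_const card_ord => /eqP.
  by rewrite mulrn_eq0 (gtn_eqF (leq_ltn_trans (leq0n _) (ltn_ord i))) => /eqP.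
(* For a kernel vector, Laplacian plus sum is zero at each state. Summing over states shows that its
   sum is zero; then its energy is zero, so it is constant, hence zero. *)
have Aunit : A \in unitmx.
  rewrite -unitmx_tr -row_free_unit -kermx_eq0; apply/eqP/row_matrixP => i.
  rewrite row0; set v := row i _.
  have /(congr1 trmx) : v *m A^T = 0.
    by apply/sub_kermxP; exact: row_sub.
  rewrite trmx_mul trmxK trmx0 => Av.
  pose f y := v^T y 0.
  have fx x : laplacian f x + \sum_y f y = 0 by rewrite -AE Av mxE.
  have f0 : \sum_y f y = 0.
    apply: (sum_cst_eq0 i).
    have : \sum_x (laplacian f x + \sum_y f y) = 0 by apply: big1.
    by rewrite big_split /= sum_laplacian add0r.
  have fc x y : f x = f y.
    apply: dirichlet_eq0; apply: big1 => z _.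
    by have := fx z; rewrite f0 addr0 => ->; rewrite mulr0.
  apply/rowP => j; rewrite [RHS]mxE; have := f0.
  rewrite (eq_bigr (fun=> f j)) => [/(sum_cst_eq0 i) <-|z _]; last exact: fc.
  by rewrite /f [RHS]mxE.
pose v := invmx A *m \col_x g x.
have vx x : laplacian (fun y => v y 0) x + \sum_y v y 0 = g x.
  by rewrite -AE mulmxA mulmxV// mul1mx mxE.
(* Since [g] has sum zero, so has [v], and the all-ones term drops out. *)
have v0 (x0 : 'I_N) : \sum_y v y 0 = 0 :> R.
  apply: (sum_cst_eq0 x0); rewrite -[RHS]g0.
  under [RHS]eq_bigr do rewrite -vx.
  by rewrite big_split /= sum_laplacian add0r.
by exists (fun y => v y 0) => x; rewrite -vx (v0 x) addr0.
Qed.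

End Laplacian.

(** * First-hit probabilities as a killed evolution *)

Section FirstHit.
Context {R : realType} {N : nat}.
Variable P : 'M[R]_N.

(** Applied before each step, not after it: mass entering [M] is thus seen exactly once, at its
    first hit. *)
Definition kill (M : {set 'I_N}) (v : 'cV[R]_N) : 'cV[R]_N :=
  \col_x if x \in M then 0 else v x 0.

Definition ffun_cons {A : Type} {t : nat} (u : A * {ffun 'I_t.+1 -> A}) :
    {ffun 'I_t.+2 -> A} :=
  [ffun i => if unlift ord0 i is Some j then u.2 j else u.1].

Lemma ffun_cons_bij (A : Type) (t : nat) : bijective (@ffun_cons A t).
Proof.
exists (fun w : {ffun 'I_t.+2 -> A} => (w ord0, [ffun j => w (lift ord0 j)]))
  => [[a w]|w].
  rewrite /ffun_cons ffunE unlift_none; congr pair.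
  by apply/ffunP => j; rewrite !ffunE liftK.
by apply/ffunP => i; rewrite ffunE; case: unliftP => [j ->|->]//=; rewrite ffunE.
Qed.

Lemma first_hit_prob0 (v : 'cV[R]_N) M :
  first_hit_prob P v M 0 = \sum_(x in M) v x 0.
Proof.
have bij : bijective (fun x : 'I_N => [ffun _ : 'I_1 => x]).
  exists (fun w : {ffun 'I_1 -> 'I_N} => w ord0) => [x|w]; first by rewrite ffunE.
  by apply/ffunP => i; rewrite ffunE; congr (w _); rewrite [RHS]ord1; apply: val_inj.
rewrite /first_hit_prob (reindex _ (onW_bij _ bij)) /=.
apply: eq_big => [x|x _]; last by rewrite /trajectory_prob big_ord0 mulr1 ffunE.
by rewrite ffunE; case: (x \in M) => //=; apply/forallP.
Qed.

(** Split off the starting state of the trajectory: it must be unmarked, and summing over it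
    produces the vector [P *m kill M v]. *)
Lemma first_hit_probS (v : 'cV[R]_N) M t :
  first_hit_prob P v M t.+1 = first_hit_prob P (P *m kill M v) M t.
Proof.
rewrite /first_hit_prob (reindex _ (onW_bij _ (ffun_cons_bij _ _))) /=.
have c0 (u : 'I_N * {ffun 'I_t.+1 -> 'I_N}) : ffun_cons u ord0 = u.1.
  by rewrite ffunE unlift_none.
have cS (u : 'I_N * {ffun 'I_t.+1 -> 'I_N}) j :
    ffun_cons u (lift ord0 j) = u.2 j.
  by rewrite ffunE liftK.
have max1 : ord_max = lift ord0 ord_max :> 'I_t.+2 by apply: val_inj.
have -> : \sum_(u | (ffun_cons u ord_max \in M) &&
     [forall i : 'I_t.+2, (i < t.+1)%N ==> (ffun_cons u i \notin M)])
     trajectory_prob P v (ffun_cons u) =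
  \sum_(u : 'I_N * {ffun 'I_t.+1 -> 'I_N} |
     (u.1 \notin M) && ((u.2 ord_max \in M) &&
     [forall i : 'I_t.+1, (i < t)%N ==> (u.2 i \notin M)]))
     (v u.1 0 * P (u.2 ord0) u.1) *
     \prod_(i < t) P (u.2 (lift ord0 i)) (u.2 (widen_ord (leqnSn t) i)).
  apply: eq_big => [u|u _].
    rewrite max1 cS andbCA; congr (_ && _).
    apply/forallP/andP => [h|[h1 /forallP h2] i].
      split; first by have := h ord0; rewrite c0.
      by apply/forallP => j; have := h (lift ord0 j); rewrite cS.
    case: (unliftP ord0 i) => [j ->|->]; last by rewrite c0 h1 implybT.
    by rewrite cS; exact: h2.
  rewrite /trajectory_prob c0 big_ord_recl cS -mulrA; congr (_ * _).
  congr (_ * _).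
    by congr (P _ _); rewrite -c0; congr (ffun_cons u _); apply: val_inj.
  apply: eq_bigr => i _; rewrite !cS; congr (P _ _).
  by rewrite -cS; congr (ffun_cons u _); apply: val_inj.
rewrite -(pair_big_dep (fun a => a \notin M)
  (fun a (w : {ffun 'I_t.+1 -> 'I_N}) => (w ord_max \in M) &&
     [forall i : 'I_t.+1, (i < t)%N ==> (w i \notin M)])
  (fun a (w : {ffun 'I_t.+1 -> 'I_N}) =>
     (v a 0 * P (w ord0) a) *
     \prod_(i < t) P (w (lift ord0 i)) (w (widen_ord (leqnSn t) i)))) /=.
rewrite exchange_big /=; apply: eq_bigr => w _.
rewrite -mulr_suml /trajectory_prob; congr (_ * _).
rewrite mxE [RHS](bigID (fun x => x \in M)) /= [X in X + _]big1 ?add0r.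
  by apply: eq_bigr => x xM; rewrite mxE (negbTE xM) mulrC.
by move=> x xM; rewrite mxE xM mulr0.
Qed.

(** * Survival probabilities and truncated means *)

Variable pi : 'cV[R]_N.
Variable M : {set 'I_N}.

(* [unhit t x] is the probability of being at [x] at time [t] without a visit
   to [M] before time [t]; a visit at time [t] itself is allowed. *)
Definition unhit (t : nat) : 'cV[R]_N := iter t (fun v => P *m kill M v) pi.

(** The probability that the hitting time exceeds [t]. *)
Definition survival (t : nat) : R := \sum_(x | x \notin M) unhit t x 0.

Lemma first_hit_probE t :
  first_hit_prob P pi M t = \sum_(x in M) unhit t x 0.
Proof.
rewrite /unhit; elim: t pi => [v|t IH v]; first exact: first_hit_prob0.
by rewrite first_hit_probS IH iterSr.
Qed.

Hypothesis walkP : random_walk P.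
Hypothesis statP : stationary P pi.

Lemma unhit_ge0 t x : 0 <= unhit t x 0.
Proof.
elim: t x => [|t IH] x; first by case: statP => + _ _; exact.
rewrite /unhit iterS mxE; apply: sumr_ge0 => y _.
by rewrite mulr_ge0 ?walkP.1// mxE; case: ifP => // _; exact: IH.
Qed.

Lemma first_hit_prob_ge0 t : 0 <= first_hit_prob P pi M t.
Proof. by rewrite first_hit_probE; apply: sumr_ge0 => x _; exact: unhit_ge0. Qed.

Lemma survival_ge0 t : 0 <= survival t.
Proof. by apply: sumr_ge0 => x _; exact: unhit_ge0. Qed.

(** Duality: the step passes from the law to the test function [h], and killed states drop out. *)
Lemma unhitS t (h : 'I_N -> R) :
  \sum_x unhit t.+1 x 0 * h x =
  \sum_(x | x \notin M) unhit t x 0 * \sum_y P y x * h y.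
Proof.
under eq_bigr do rewrite /unhit iterS mxE mulr_suml.
rewrite exchange_big /= [LHS](bigID (fun x => x \in M)) /= [X in X + _]big1 ?add0r.
  apply: eq_bigr => x xM; rewrite mulr_sumr; apply: eq_bigr => y _.
  by rewrite mxE (negbTE xM) mulrAC mulrC mulrA.
by move=> x xM; apply: big1 => y _; rewrite mxE xM mulr0 mul0r.
Qed.

Lemma first_hit_prob_survival0 : first_hit_prob P pi M 0 = 1 - survival 0.
Proof.
have [_ <- _] := statP.
by rewrite first_hit_probE [X in X - _](bigID (fun x => x \in M)) /= addrK.
Qed.

Lemma first_hit_prob_survivalS t :
  first_hit_prob P pi M t.+1 = survival t - survival t.+1.
Proof.
(* This is [unhitS] with the constant test function 1. *)
have : \sum_x unhit t.+1 x 0 = survival t.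
  under eq_bigr do rewrite -[unhit _ _ _]mulr1.
  rewrite unhitS; apply: eq_bigr => x _.
  by under eq_bigr do rewrite mulr1; rewrite (walkP.2 x) mulr1.
rewrite first_hit_probE => <-.
by rewrite [X in X - _](bigID (fun x => x \in M)) /= addrK.
Qed.

Lemma sum_first_hit_prob n :
  \sum_(0 <= t < n.+1) first_hit_prob P pi M t = 1 - survival n.
Proof.
elim: n => [|n IH]; first by rewrite big_nat1 first_hit_prob_survival0.
by rewrite big_nat_recr//= IH first_hit_prob_survivalS; ring.
Qed.

(** Summation by parts: first-hit probabilities are the decrements of [survival]. *)
Lemma sum_mean_first_hit n :
  \sum_(0 <= t < n.+1) t%:R * first_hit_prob P pi M t =
  \sum_(0 <= t < n) survival t - n%:R * survival n.
Proof.
elim: n => [|n IH]; first by rewrite big_nat1 big_geq// !mul0r subr0.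
rewrite big_nat_recr//= IH first_hit_prob_survivalS big_nat_recr//= -natr1; ring.
Qed.

Lemma survival_noninc t n : (t <= n)%N -> survival n <= survival t.
Proof.
elim: n => [|n IH]; first by rewrite leqn0 => /eqP ->.
rewrite leq_eqVlt => /orP[/eqP -> //|/IH]; apply: le_trans.
by rewrite -subr_ge0 -first_hit_prob_survivalS first_hit_prob_ge0.
Qed.

Lemma survival_sum_ge T : T%:R * survival T <= \sum_(0 <= t < T) survival t.
Proof.
rewrite big_mkord -[X in X%:R * _]card_ord mulr_natl -sumr_const.
by apply: ler_sum => t _; apply: survival_noninc; exact/ltnW.
Qed.

(** With [tau] the hitting time, this integrates [T <= tau + max(T - tau, 0)] over the event
    [tau < n]; the last bracket is the full mean of [max(T - tau, 0)]. *)
Lemma truncated_mean_le T n :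
  T%:R * (\sum_(0 <= t < n) first_hit_prob P pi M t) <=
  \sum_(0 <= t < n) t%:R * first_hit_prob P pi M t
  + (T%:R - \sum_(0 <= t < T) survival t).
Proof.
case: n => [|n].
  rewrite [X in _ * X <= _]big_geq// [X in X + _]big_geq// mulr0 add0r subr_ge0.
  rewrite big_mkord -[leRHS]mulr1 -[X in X%:R * _]card_ord mulr_natl -sumr_const.
  apply: ler_sum => t _; apply: le_trans (survival_noninc _ _ (leq0n t)) _.
  by rewrite -subr_ge0 -first_hit_prob_survival0 first_hit_prob_ge0.
rewrite sum_first_hit_prob sum_mean_first_hit.
rewrite mulrBr mulr1 addrCA lerD2l -subr_ge0.
have -> : \sum_(0 <= t < n) survival t - n%:R * survival n -
    \sum_(0 <= t < T) survival t - - (T%:R * survival n) =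
  (\sum_(0 <= t < n) survival t - n%:R * survival n) -
  (\sum_(0 <= t < T) survival t - T%:R * survival n) by ring.
have sumc m : \sum_(0 <= t < m) survival t - m%:R * survival n =
    \sum_(0 <= t < m) (survival t - survival n).
  by rewrite sumrB sumr_const_nat subn0 mulr_natl.
(* The common terms cancel; monotonicity of [survival] gives the remaining ones, between [n] and
   [T], the right sign in either order. *)
rewrite !sumc; have [nT|Tn] := leqP n T.
  rewrite (@big_cat_nat _ _ _ n 0%N T)//= opprD addrA subrr add0r oppr_ge0.
  rewrite big_nat; apply: sumr_le0 => t /andP[nt _].
  by rewrite subr_le0 survival_noninc.
rewrite (@big_cat_nat _ _ _ T 0%N n)//= 1?ltnW// addrAC subrr add0r.
rewrite big_nat; apply: sumr_ge0 => t /andP[_ tn].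
by rewrite subr_ge0 survival_noninc// ltnW.
Qed.

(** The partial sum is the mean of the minimum of [T] and the hitting time. *)
Lemma hitting_time_ge T :
  ((\sum_(0 <= t < T) survival t)%:E <= hitting_time P pi M)%E.
Proof.
rewrite /hitting_time.
set S1 := (\sum_(0 <= t <oo) (t%:R * _)%:E)%E.
set S0 := (\sum_(0 <= t <oo) _)%E.
have p0 t : (0 <= (first_hit_prob P pi M t)%:E)%E.
  by rewrite lee_fin first_hit_prob_ge0.
have tp0 t : (0 <= (t%:R * first_hit_prob P pi M t)%:E)%E.
  by rewrite lee_fin mulr_ge0 ?first_hit_prob_ge0.
have S1_ge0 : (0 <= S1)%E by apply: nneseries_ge0 => t _ _; exact: tp0.
have S0le1 : (S0 <= 1)%E.
  apply: lime_le; first by apply: is_cvg_nneseries => t _ _; exact: p0.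
  apply: nearW => n; rewrite sumEFin lee_fin.
  case: n => [|n]; first by rewrite big_geq.
  by rewrite sum_first_hit_prob gerBl survival_ge0.
have S0fin : S0 \is a fin_num.
  rewrite fin_numElt (lt_le_trans ltNy0) ?(le_lt_trans S0le1) ?ltry//.
  by apply: nneseries_ge0 => t _ _; exact: p0.
(* [S0] is the probability of ever hitting [M]. If it is 1, let [n] tend to infinity in
   [truncated_mean_le]; if it is smaller, the hitting time is infinite. *)
have [S0lt|] := ltP S0 1%E; last first.
  move=> S0ge; have -> : S0 = 1%E by apply/eqP; rewrite eq_le S0le1.
  rewrite subee// mul0e adde0.
  have [S1fin|] := boolP (S1 \is a fin_num); last first.
    by rewrite ge0_fin_numE// -leNgt leye_eq => /eqP ->; exact: leey.
  have [T0|Tpos] := posnP T; first by rewrite T0 big_geq.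
  have TR : 0 < T%:R :> R by rewrite ltr0n.
  have : (S0 <= ((fine S1 + (T%:R - \sum_(0 <= t < T) survival t)) / T%:R)%:E)%E.
    apply: lime_le; first by apply: is_cvg_nneseries => t _ _; exact: p0.
    apply: nearW => n; rewrite sumEFin lee_fin ler_pdivlMr// mulrC.
    apply: le_trans (truncated_mean_le T n) _; rewrite lerD2r -lee_fin fineK//.
    by rewrite -sumEFin; apply: nneseries_lim_ge => t _ _; exact: tp0.
  move=> /(le_trans S0ge); rewrite lee_fin ler_pdivlMr// mul1r => h.
  by rewrite -(fineK S1fin) lee_fin; move: h; lra.
have -> : ((1 - S0) * +oo = +oo)%E by rewrite gt0_muley// sube_gt0.
by rewrite addey ?leey// gt_eqF// (lt_le_trans ltNy0).
Qed.

(* Dynkin's formula at the stopping time min(T, hitting time). *)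
Lemma dynkin (h : 'I_N -> R) T :
  (forall x, x \in M -> h x = 0) ->
  (forall x, x \notin M -> h x = 1 + \sum_y P y x * h y) ->
  \sum_x pi x 0 * h x = \sum_(0 <= t < T) survival t
                        + \sum_(x | x \notin M) unhit T x 0 * h x.
Proof.
move=> hM hU; elim: T => [|T ->].
  rewrite big_geq// add0r (bigID (fun x => x \in M)) /= big1 ?add0r// => x xM.
  by rewrite hM// mulr0.
rewrite big_nat_recr//= -addrA; congr (_ + _).
have -> : \sum_(x | x \notin M) unhit T.+1 x 0 * h x
        = \sum_x unhit T.+1 x 0 * h x.
  rewrite [RHS](bigID (fun x => x \in M)) /= [X in _ = X + _]big1 ?add0r// => x xM.
  by rewrite hM// mulr0.
rewrite unhitS /survival -big_split /=; apply: eq_bigr => x xM.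
by rewrite {1}hU// mulrDr mulr1.
Qed.

(** The remainder in [dynkin] is at most [H * survival T]. Once [T >= H], monotonicity bounds this
    by the partial sum of survivals itself, whence the factor 2. *)
Lemma mean_le_hitting_time (h : 'I_N -> R) :
  (forall x, x \in M -> h x = 0) ->
  (forall x, x \notin M -> h x = 1 + \sum_y P y x * h y) ->
  ((\sum_x pi x 0 * h x)%:E <= 2%:E * hitting_time P pi M)%E.
Proof.
move=> hM hU; set H := \sum_x `|h x|.
have H0 : 0 <= H by apply: sumr_ge0.
pose T := Num.bound H.
have HT : H <= T%:R by rewrite ltW// archi_boundP.
apply: (@le_trans _ _ (2%:E * (\sum_(0 <= t < T) survival t)%:E)%E).
  rewrite -EFinM lee_fin (dynkin h T)// mulr_natl mulr2n lerD2l.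
  apply: le_trans (survival_sum_ge T).
  apply: (@le_trans _ _ (H * survival T)).
    rewrite mulr_sumr; apply: ler_sum => x _; rewrite mulrC.
    apply: ler_wpM2r; first exact: unhit_ge0.
    apply: le_trans (ler_norm _) _.
    by rewrite /H (bigD1 x)//= lerDl sumr_ge0.
  by apply: ler_wpM2r => //; exact: survival_ge0.
by apply: lee_wpmul2l; rewrite ?lee_fin// hitting_time_ge.
Qed.

End FirstHit.

(** * Parseval's identity *)

Section OrthonormalBasis.
Context {R : realType} {N : nat}.
Variable psi : 'I_N -> 'cV[R]_N.
Hypothesis psi_on : forall j k, dotcol (psi j) (psi k) = (j == k)%:R.

(** The matrix of the [psi k] is square, so its left inverse [Q^T] is also a right inverse. *)
Lemma parseval (u v : 'cV[R]_N) :
  \sum_k dotcol (psi k) u * dotcol (psi k) v = dotcol u v.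
Proof.
pose Q := \matrix_(x, k) psi k x 0.
have QQ : Q^T *m Q = 1%:M.
  apply/matrixP => j k; rewrite !mxE -psi_on; apply: eq_bigr => x _.
  by rewrite !mxE.
have dotE w k : dotcol (psi k) w = (Q^T *m w) k 0.
  by rewrite mxE; apply: eq_bigr => x _; rewrite !mxE.
transitivity (((Q^T *m u)^T *m (Q^T *m v)) 0 0).
  by rewrite mxE; apply: eq_bigr => k _; rewrite !dotE [in RHS]mxE.
rewrite trmx_mul trmxK mulmxA -(mulmxA _ Q) (mulmx1C QQ) mulmx1 mxE.
by apply: eq_bigr => x _; rewrite mxE.
Qed.

End OrthonormalBasis.

Lemma col_subE {R : realType} {N} (u v : 'cV[R]_N) x :
  (u - v) x 0 = u x 0 - v x 0.
Proof. by rewrite !mxE. Qed.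

(** * The discriminant of the interpolated walk *)

Section Interpolated.
Context {R : realType} {N : nat}.
Variables (P : 'M[R]_N) (pi : 'cV[R]_N) (M : {set 'I_N}).
Hypothesis walkP : random_walk P.
Hypothesis revP : reversible P pi.
Hypothesis statP : stationary P pi.
Hypothesis connP : strongly_connected (walk_edge P).
Hypothesis Mn0 : M != finset.set0.

Variable s : R.
Hypothesis s01 : 0 <= s < 1.

(** [P(s)] is reversible for the weights [pi] on [M] and [(1 - s) * pi] off [M]. [alpha] is the
    square root of the factor, [pM] the marked mass, [Z] the total weight. *)
Let r := Num.sqrt (1 - s).
Let alpha x : R := if x \in M then 1 else r.
Let pM := \sum_(x in M) pi x 0.
Let Z := pM + r ^+ 2 * (1 - pM).
(* The square root of the unnormalized stationary distribution of the
   interpolated walk. *)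
Let sw x := alpha x * Num.sqrt (pi x 0).
Let D := discriminant (interpolated_walk P M s).

Let r_gt0 : 0 < r.
Proof. by case/andP: s01 => _ s1; rewrite sqrtr_gt0 subr_gt0. Qed.

Let r2E : r ^+ 2 = 1 - s.
Proof. by case/andP: s01 => _ s1; rewrite sqr_sqrtr// subr_ge0 ltW. Qed.

Let pi_gt0 x : 0 < pi x 0. Proof. exact: (@stationary_gt0 R N P). Qed.

Let sw_gt0 x : 0 < sw x.
Proof. by rewrite mulr_gt0 ?sqrtr_gt0// /alpha; case: ifP. Qed.

Let sw2 x : sw x ^+ 2 = alpha x ^+ 2 * pi x 0.
Proof. by rewrite exprMn sqr_sqrtr// ltW. Qed.

Lemma marked_mass_gt0 : 0 < pM.
Proof.
have /set0Pn[m mM] := Mn0; rewrite /pM (bigD1 m)//= ltr_wpDr//.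
by apply: sumr_ge0 => x _; exact: ltW.
Qed.

Lemma marked_mass_le1 : pM <= 1.
Proof.
have [_ <- _] := statP; rewrite /pM [leRHS](bigID (fun x => x \in M)) /=.
by rewrite lerDl; apply: sumr_ge0 => x _; exact: ltW.
Qed.

Let Z_gt0 : 0 < Z.
Proof.
by rewrite ltr_pwDl ?marked_mass_gt0// mulr_ge0 ?sqr_ge0// subr_ge0 marked_mass_le1.
Qed.

Let walk_sym x y : alpha y ^+ 2 * pi y 0 * interpolated_walk P M s x y =
  r ^+ 2 * (pi y 0 * P x y) + (x == y)%:R * (alpha y ^+ 2 - r ^+ 2) * pi y 0.
Proof. by rewrite !mxE /alpha; case: ifP => _; rewrite r2E; ring. Qed.

(** Detailed balance for [P(s)] makes the product under the root a perfect square. *)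
Let discriminantE x y : sw x * D x y * sw y =
  r ^+ 2 * (pi y 0 * P x y) + (x == y)%:R * (alpha y ^+ 2 - r ^+ 2) * pi y 0.
Proof.
rewrite -walk_sym; set Q := interpolated_walk P M s.
have bal : alpha x ^+ 2 * pi x 0 * Q y x = alpha y ^+ 2 * pi y 0 * Q x y.
  rewrite !walk_sym; congr (_ * _ + _); first by rewrite ![pi _ _ * _]mulrC revP.
  by rewrite eq_sym; case: eqP => [->//|_]; rewrite !mul0r.
have Q0 a b : 0 <= Q a b.
  case/andP: s01 => s0 s1; rewrite !mxE; apply: addr_ge0; apply: mulr_ge0 => //.
  - by rewrite subr_ge0 ltW.
  - exact: walkP.1.
  - by case: ifP => // _; exact: walkP.1.
have swE a : sw a = Num.sqrt (alpha a ^+ 2 * pi a 0).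
  by rewrite -sw2 sqrtr_sqr ger0_norm//; exact: ltW.
have ap0 a : 0 <= alpha a ^+ 2 * pi a 0 by rewrite -sw2 sqr_ge0.
rewrite mxE !swE -sqrtrM// -sqrtrM; last by rewrite mulr_ge0// mulr_ge0.
have -> : alpha x ^+ 2 * pi x 0 * (Q x y * Q y x) * (alpha y ^+ 2 * pi y 0) =
  (alpha y ^+ 2 * pi y 0 * Q x y) ^+ 2 by rewrite [RHS]expr2 -{1}bal; ring.
by rewrite sqrtr_sqr ger0_norm// mulr_ge0.
Qed.

(* Conjugating [1 - D] by [sw] yields the Laplacian of [P], up to the scalar
   [1 - s]: the marked set and [s] have disappeared from the operator. *)
Lemma discriminant_laplacian (f : 'I_N -> R) x :
  sw x * (sw x * f x - (D *m \col_y (sw y * f y)) x 0) =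
  r ^+ 2 * laplacian P pi f x.
Proof.
rewrite laplacianE// mulrBr mxE mulr_sumr.
have -> : \sum_y sw x * (D x y * (\col_y0 (sw y0 * f y0)) y 0) =
  \sum_y (r ^+ 2 * (pi y 0 * P x y * f y)) +
  \sum_y (x == y)%:R * (alpha y ^+ 2 - r ^+ 2) * pi y 0 * f y.
  rewrite -big_split; apply: eq_bigr => y _ /=.
  by rewrite mxE mulrA mulrA discriminantE; ring.
rewrite -mulr_sumr mulrA -expr2 sw2 [X in _ - (_ + X)](bigD1 x)//= eqxx.
rewrite [X in _ - (_ + (_ + X))]big1 ?addr0; first by rewrite /=; ring.
by move=> y yx; rewrite eq_sym (negbTE yx) !mul0r.
Qed.

Let D_sym u v : dotcol u (D *m v) = dotcol (D *m u) v.
Proof.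
rewrite /dotcol; under eq_bigr do rewrite mxE mulr_sumr.
under [RHS]eq_bigr do rewrite mxE mulr_suml.
rewrite exchange_big /=; apply: eq_bigr => y _; apply: eq_bigr => x _.
by rewrite [D x y]mxE [D y x]mxE (mulrC (interpolated_walk _ _ _ _ _)); ring.
Qed.

(** * Eigenvalues of the discriminant and the spectral sum *)

Variables (lam : 'I_N -> R) (psi : 'I_N -> 'cV[R]_N).
Hypothesis eigD : ordered_eigenbasis D lam psi.

Let psi_on j k : dotcol (psi j) (psi k) = (j == k)%:R.
Proof. by have [+ _ _] := eigD; exact. Qed.

Let psi_eig k : D *m psi k = lam k *: psi k.
Proof. by have [_ + _] := eigD; exact. Qed.

Let psi_laplacian k x : sw x * ((1 - lam k) * psi k x 0) =
  r ^+ 2 * laplacian P pi (fun y => psi k y 0 / sw y) x.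
Proof.
rewrite -discriminant_laplacian.
have -> : \col_y (sw y * (psi k y 0 / sw y)) = psi k.
  by apply/colP => y; rewrite mxE mulrC divfK// gt_eqF.
by rewrite psi_eig mxE [sw x * (_ / _)]mulrC divfK ?gt_eqF//; ring.
Qed.

(** Spectral gaps are energies: hence no eigenvalue exceeds 1, and equality forces [psi k] to be
    proportional to [sw]. *)
Let gapE k : 1 - lam k =
  r ^+ 2 * dirichlet P pi (fun y => psi k y 0 / sw y) (fun y => psi k y 0 / sw y).
Proof.
transitivity ((1 - lam k) * dotcol (psi k) (psi k)).
  by rewrite psi_on eqxx mulr1.
rewrite !mulr_sumr; apply: eq_bigr => x _.
rewrite [RHS]mulrCA -psi_laplacian [RHS]mulrA divfK ?gt_eqF//; ring.
Qed.

Let lam_le1 k : lam k <= 1.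
Proof.
by rewrite -subr_ge0 gapE mulr_ge0 ?sqr_ge0// dirichlet_ge0.
Qed.

Let top_eigenvector k x y : lam k = 1 -> psi k x 0 / sw x = psi k y 0 / sw y.
Proof.
move=> k1; apply: (@dirichlet_eq0 _ _ _ _ walkP revP statP connP
                         (fun y => psi k y 0 / sw y)).
have /eqP := gapE k; rewrite k1 subrr eq_sym mulf_eq0 sqrf_eq0 gt_eqF//=.
by move=> /eqP.
Qed.

Let dot_eig k u : dotcol (psi k) (u - D *m u) = (1 - lam k) * dotcol (psi k) u.
Proof.
have -> : dotcol (psi k) (u - D *m u) = dotcol (psi k) u - dotcol (psi k) (D *m u).
  by rewrite -sumrB; apply: eq_bigr => x _; rewrite col_subE mulrBr.
rewrite D_sym psi_eig mulrBl mul1r; congr (_ - _).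
by rewrite mulr_sumr; apply: eq_bigr => x _; rewrite mxE mulrA.
Qed.

Let v1 := \col_x sw x.

Let D_v1 : v1 - D *m v1 = 0.
Proof.
have -> : v1 = \col_y (sw y * (fun=> 1) y) by apply/colP => y; rewrite !mxE mulr1.
apply/colP => x; apply/eqP; rewrite col_subE [X in _ == X]mxE.
have /eqP := discriminant_laplacian (fun=> 1) x.
rewrite /laplacian; under eq_bigr do rewrite mulr1.
rewrite (walkP.2 x) subrr !mulr0 mulf_eq0 gt_eqF//=.
by rewrite [(\col_y _) _ _]mxE.
Qed.

Let v1_eig k : (1 - lam k) * dotcol (psi k) v1 = 0.
Proof. by rewrite -dot_eig D_v1; apply: big1 => x _; rewrite mxE mulr0. Qed.

Let v1_dot : dotcol v1 v1 = Z.
Proof.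
rewrite /dotcol; under eq_bigr do rewrite mxE -expr2 sw2.
rewrite (bigID (fun x => x \in M)) /= /Z; congr (_ + _).
  by apply: eq_bigr => x xM; rewrite /alpha xM expr1n mul1r.
have [_ <- _] := statP.
rewrite [X in X - _](bigID (fun x => x \in M)) /= addrAC subrr add0r.
by rewrite mulr_sumr; apply: eq_bigr => x /negbTE xM; rewrite /alpha xM.
Qed.

(** If [lam k = 1], the ordering makes [lam] equal 1 at index 0 too; two orthogonal unit vectors
    would then both be multiples of [v1]. *)
Let lam_neq1 (k : 'I_N) : (0 < k)%N -> lam k != 1.
Proof.
move=> k0; apply/eqP => lk1.
have N0 : (0 < N)%N by apply: leq_ltn_trans (ltn_ord k).
pose i0 := Ordinal N0.
have li1 : lam i0 = 1.
  have [_ _ ord] := eigD.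
  by apply/eqP; rewrite eq_le lam_le1 -lk1; apply: ord.
have := psi_on i0 k; have -> : (i0 == k) = false.
  by apply/negbTE; rewrite -val_eqE /= neq_ltn k0.
have psiE j : lam j = 1 -> psi j = (psi j i0 0 / sw i0) *: v1.
  move=> lj; apply/colP => x; rewrite mxE mxE (top_eigenvector _ i0 x)//.
  by rewrite divfK// gt_eqF.
have nz j : lam j = 1 -> psi j i0 0 / sw i0 != 0.
  move=> lj; apply/eqP => c0; have := psi_on j j; rewrite eqxx psiE// c0 scale0r.
  rewrite /dotcol big1 => [/esym/eqP|x _]; first by rewrite oner_eq0.
  by rewrite mxE mul0r.
rewrite (psiE i0)// (psiE k)//.
move: (nz _ li1) (nz _ lk1); move: (_ / _) (psi k _ _ / _) => a b a0 b0.
have -> : dotcol (a *: v1) (b *: v1) = a * b * dotcol v1 v1.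
  by rewrite mulr_sumr; apply: eq_bigr => x _; rewrite !mxE mulrACA.
move=> /eqP; rewrite v1_dot !mulf_eq0 (gt_eqF Z_gt0) orbF.
by rewrite (negbTE a0) (negbTE b0).
Qed.

(** Otherwise [v1], fixed by [D], would be orthogonal to the whole basis, against Parseval. *)
Let lam_top (k : 'I_N) : ~~ (0 < k)%N -> lam k = 1.
Proof.
move=> k0; apply/eqP/negPn/negP => lk1.
have dot0 j : dotcol (psi j) v1 = 0.
  have /eqP := v1_eig j; rewrite mulf_eq0 subr_eq0 eq_sym => /orP[|/eqP//].
  have [/lam_neq1/negbTE -> //|j0] := boolP (0 < j)%N.
  suff -> : j = k by rewrite (negbTE lk1).
  by apply: val_inj; move: j0 k0; rewrite -!eqn0Ngt /= => /eqP -> /eqP ->.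
have := parseval psi psi_on v1 v1; rewrite v1_dot big1 => [/eqP|j _].
  by rewrite eq_sym gt_eqF.
by rewrite dot0 mul0r.
Qed.

(** Write the component [b] of the square-root state orthogonal to [v1] as [(1 - D) z]. Each summand
    becomes a product of coefficients of [b] and [z], and Parseval sums these to an energy of
    [f]. *)
Lemma spectral_sumE (f : 'I_N -> R) :
  (forall x, laplacian P pi f x =
     pi x 0 - (if x \in M then pi x 0 / pM else 0)) ->
  spectral_sum pi lam psi =
  (pM * (1 - r) / Z) ^+ 2 * dirichlet P pi f f.
Proof.
(* [kappa] is the projection coefficient on [v1]; [c] is the scale for which [swb] holds. *)
move=> fE; pose c := pM * (1 - r) / (r * Z).
pose kappa := (pM + r * (1 - pM)) / Z.
pose z := \col_y (sw y * (c * f y)).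
pose b := sqrt_state pi - kappa *: v1.
have swb x : sw x * b x 0 = r ^+ 2 * (c * laplacian P pi f x).
  have -> : sw x * b x 0 = alpha x * pi x 0 - kappa * (alpha x ^+ 2 * pi x 0).
    rewrite col_subE !mxE /sw; set q := Num.sqrt _.
    have <- : q ^+ 2 = pi x 0 by apply: sqr_sqrtr; exact: ltW.
    ring.
  rewrite fE /alpha /kappa /c; have := marked_mass_gt0.
  move: Z_gt0 r_gt0; rewrite /Z => Zp rp pp.
  by case: ifP => _; field; rewrite ?gt_eqF.
have zE : z - D *m z = b.
  apply/colP => x; apply/(mulfI (lt0r_neq0 (sw_gt0 x))).
  rewrite swb col_subE [z _ _]mxE discriminant_laplacian.
  congr (_ * _); rewrite /laplacian.
  under eq_bigr do rewrite mulrCA.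
  by rewrite -mulr_sumr; ring.
have dotb k : dotcol (psi k) b =
    dotcol (psi k) (sqrt_state pi) - kappa * dotcol (psi k) v1.
  rewrite mulr_sumr -sumrB; apply: eq_bigr => x _.
  have -> : b x 0 = sqrt_state pi x 0 - kappa * v1 x 0.
    by rewrite col_subE; congr (_ - _); rewrite mxE.
  ring.
have sumE : spectral_sum pi lam psi =
    \sum_k dotcol (psi k) b * dotcol (psi k) z.
  (* The index 0 can be added for free: there [1 - lam k] is zero. *)
  rewrite [RHS](bigID (fun k : 'I_N => (0 < k)%N)) /= [X in _ = _ + X]big1 ?addr0.
    apply: eq_bigr => k k0; have lk := lam_neq1 _ k0.
    have lk' : 1 - lam k != 0 by rewrite subr_eq0 eq_sym.
    have v0 : dotcol (psi k) v1 = 0.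
      by have /eqP := v1_eig k; rewrite mulf_eq0 (negbTE lk') => /eqP.
    have := dotb k; rewrite v0 mulr0 subr0 => <-.
    rewrite real_normK ?num_real// -zE dot_eig; field.
    by rewrite subr_eq0 in lk' *.
  by move=> k k0; rewrite -zE dot_eig (lam_top _ k0) subrr !mul0r.
rewrite sumE parseval//.
transitivity (\sum_x r ^+ 2 * (c * laplacian P pi f x) * (c * f x)).
  apply: eq_bigr => x _; rewrite -swb [z _ _]mxE; ring.
rewrite mulr_sumr; apply: eq_bigr => x _.
rewrite /c; have := Z_gt0; have := r_gt0 => rp Zp; field.
by rewrite !gt_eqF.
Qed.

End Interpolated.

(** * The limit of the scalar factor, and the energy for one marked state *)

Lemma scale_limit (R : realType) (p q : R) : 0 < p ->
  ((p * (1 - Num.sqrt (1 - s)) / (p + Num.sqrt (1 - s) ^+ 2 * (1 - p))) ^+ 2 * q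
    @[s --> 1^'-] --> q)%classic.
Proof.
(* The two-sided limit exists, as [Num.sqrt] is continuous everywhere, with value 0 on negative
   numbers. *)
move=> p0; apply: cvg_at_left_filter.
have r0 : (Num.sqrt (1 - s) @[s --> (1 : R)] --> (0 : R))%classic.
  have := @continuous_cvg _ _ _ (nbhs (1 : R)) _ (fun s : R => 1 - s) (@Num.sqrt R) 0.
  rewrite sqrtr0; apply; first exact: sqrt_continuous.
  by rewrite -(subrr (1 : R)); apply: cvgB; [exact: cvg_cst|exact: cvg_id].
pose den (s : R) := p + Num.sqrt (1 - s) * Num.sqrt (1 - s) * (1 - p).
have den_lim : (den s @[s --> (1 : R)] --> p + 0 * 0 * (1 - p))%classic.
  by apply: cvgD; [exact: cvg_cst|apply: cvgM; [exact: cvgM|exact: cvg_cst]].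
pose ratio (s : R) := p * (1 - Num.sqrt (1 - s)) / den s.
have ratio_lim : (ratio s @[s --> (1 : R)] --> (1 : R))%classic.
  rewrite [X in (_ --> X)%classic](_ : 1 = p * (1 - 0) / (p + 0 * 0 * (1 - p))).
    2: by rewrite !mul0r addr0 subr0 mulr1 divff ?gt_eqF.
  apply: cvgM; last by apply: cvgV => //; rewrite !mul0r addr0 gt_eqF.
  by apply: cvgM; [exact: cvg_cst|apply: cvgB => //; exact: cvg_cst].
rewrite [X in (_ --> X)%classic](_ : q = 1 * 1 * q).
  by apply: cvgM; [exact: cvgM|exact: cvg_cst].
by rewrite !mul1r.
Qed.

(** Shifted to vanish at [m], the potential [h] solves the equations of the expected hitting time of
    [m], and its [pi]-mean is the energy. *)
Lemma dirichlet_le_hitting_time (R : realType) (N : nat) (P : 'M[R]_N)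
    (pi : 'cV[R]_N) (m : 'I_N) (h : 'I_N -> R) :
  random_walk P -> reversible P pi -> stationary P pi ->
  strongly_connected (walk_edge P) ->
  (forall x, laplacian P pi h x = pi x 0 - (x == m)%:R) ->
  ((dirichlet P pi h h)%:E <= 2%:E * hitting_time P pi [set m]%SET)%E.
Proof.
move=> walkP revP statP connP hE.
pose k x := h x - h m.
have -> : dirichlet P pi h h = \sum_x pi x 0 * k x.
  have [_ pi1 _] := statP.
  transitivity (\sum_x pi x 0 * h x - h m).
    rewrite /dirichlet; under eq_bigr do rewrite hE mulrBr mulrC.
    rewrite sumrB; congr (_ - _); rewrite (bigD1 m)//= eqxx mulr1 big1 ?addr0//.
    by move=> x /negbTE ->; rewrite mulr0.
  under [RHS]eq_bigr do rewrite mulrBr.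
  by rewrite sumrB -mulr_suml pi1 mul1r.
apply: mean_le_hitting_time => // x; rewrite inE.
  by move=> /eqP ->; rewrite /k subrr.
move=> xm; have pix := stationary_gt0 _ _ revP statP connP x.
have := hE x; rewrite (negbTE xm) subr0 -[RHS]mulr1 /laplacian.
move=> /(mulfI (lt0r_neq0 pix)) => e.
rewrite /k; under eq_bigr do rewrite mulrBr.
by rewrite sumrB -mulr_suml (walkP.2 x) mul1r; move: e; lra.
Qed.

(** * Assembly by convexity over the marked states *)

Theorem corollary3 (R : realType) :
  exists2 C : R, 0 < C &
    forall (N : nat) (P : 'M[R]_N) (pi : 'cV[R]_N) (M : {set 'I_N}),
      random_walk P -> ergodic P -> stationary P pi -> reversible P pi ->
      M != finset.set0 ->
      exists2 h : R, is_extended_hitting_time P pi M h &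
        (h%:E <= C%:E * \big[maxe/-oo]_(m in M) hitting_time P pi [set m]%SET)%E.
Proof.
(* The constant comes from [mean_le_hitting_time] alone. *)
exists 2 => // N P pi M walkP [connP _] statP revP Mn0.
have pM0 := marked_mass_gt0 P pi M revP statP connP Mn0.
set pM := \sum_(x in M) pi x 0 in pM0.
have [_ pi1 _] := statP.
have src0 : \sum_x (pi x 0 - (if x \in M then pi x 0 / pM else 0)) = 0.
  by rewrite sumrB -big_mkcond /= -mulr_suml pi1 divff ?gt_eqF// subrr.
have [f fE] := poisson _ _ walkP revP statP connP _ src0.
have delta0 m : \sum_x (pi x 0 - (x == m)%:R) = 0.
  rewrite sumrB pi1 (bigD1 m)//= eqxx big1 ?addr0 ?subrr//.
  by move=> x /negbTE ->.
have [h hE] := choice (fun m => poisson _ _ walkP revP statP connP _ (delta0 m)).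
exists (dirichlet P pi f f).
  move=> lam psi eig.
  have lim := scale_limit R pM (dirichlet P pi f f) pM0.
  apply: cvg_trans lim; apply: near_eq_cvg; near=> s.
  have s01 : 0 <= s < 1.
    apply/andP; split; near: s; last exact: nbhs_left_lt.
    by apply: nbhs_left_ge.
  by rewrite (spectral_sumE P pi M walkP revP statP connP Mn0 s s01
                _ _ (eig s s01) f fE).
(* [dirichlet f f] averages the cross energies of [f] and the potentials [h m]
   with weights [pi m / pM], and a cross energy is at most the mean of the two
   energies. *)
have avg : dirichlet P pi f f <=
    \sum_(m in M) pi m 0 / pM * dirichlet P pi (h m) (h m).
  have w1 : \sum_(m in M) pi m 0 / pM = 1 by rewrite -mulr_suml divff ?gt_eqF.
  (* The source of [f] is the weighted mean of the sources of the [h m]. *)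
  have fh : dirichlet P pi f f =
      \sum_(m in M) pi m 0 / pM * dirichlet P pi (h m) f.
    rewrite [LHS]/dirichlet.
    transitivity (\sum_x f x *
      \sum_(m in M) pi m 0 / pM * (pi x 0 - (x == m)%:R)).
      apply: eq_bigr => x _; rewrite fE; congr (_ * _).
      under [RHS]eq_bigr do rewrite mulrBr.
      rewrite sumrB -mulr_suml w1 mul1r; congr (_ - _).
      case: ifP => xM.
        rewrite (bigD1 x)//= eqxx mulr1 big1 ?addr0// => m /andP[_].
        by rewrite eq_sym => /negbTE ->; rewrite mulr0.
      rewrite big1// => m mM; have [xm|] := eqVneq x m; last by rewrite mulr0.
      by rewrite -xm xM in mM.
    under eq_bigr do rewrite mulr_sumr.
    rewrite exchange_big /=; apply: eq_bigr => m _.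
    by rewrite mulr_sumr; apply: eq_bigr => x _; rewrite hE mulrCA.
  have : \sum_(m in M) pi m 0 / pM * (2 * dirichlet P pi (h m) f) <=
     \sum_(m in M) pi m 0 / pM * (dirichlet P pi (h m) (h m) + dirichlet P pi f f).
    apply: ler_sum => m _; apply: ler_wpM2l; last exact: dirichlet_cross_le.
    by rewrite divr_ge0 ?(ltW (stationary_gt0 _ _ revP statP connP _))// ltW.
  under [X in _ <= X]eq_bigr do rewrite mulrDr.
  rewrite big_split /= -mulr_suml w1 mul1r.
  under eq_bigr do rewrite mulrCA.
  by rewrite -mulr_sumr -fh; lra.
have [m mM le_m] : exists2 m, m \in M &
    dirichlet P pi f f <= dirichlet P pi (h m) (h m).
  apply: contrapT => no.
  suff : dirichlet P pi f f < dirichlet P pi f f by rewrite ltxx.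
  apply: le_lt_trans avg _.
  have lt_m m : m \in M -> dirichlet P pi (h m) (h m) < dirichlet P pi f f.
    by move=> mM; rewrite ltNge; apply/negP => le_m; apply: no; exists m.
  have -> : dirichlet P pi f f = \sum_(m in M) pi m 0 / pM * dirichlet P pi f f.
    by rewrite -mulr_suml -mulr_suml divff ?gt_eqF// mul1r.
  have /set0Pn[m0 m0M] := Mn0.
  have wpos m : 0 < pi m 0 / pM.
    by rewrite divr_gt0// (stationary_gt0 _ _ revP statP connP).
  rewrite (bigD1 m0)//= [ltRHS](bigD1 m0)//=; apply: ltr_leD.
    by rewrite ltr_pM2l// lt_m.
  by apply: ler_sum => m /andP[mM _]; rewrite ler_wpM2l ?ltW// lt_m.
apply: (@le_trans _ _ (2%:E * hitting_time P pi [set m]%SET)%E).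
  apply: le_trans (dirichlet_le_hitting_time _ _ _ _ m (h m)
                     walkP revP statP connP (hE m)).
  by rewrite lee_fin.
apply: lee_wpmul2l; first by rewrite lee_fin.
exact: (le_bigmax_cond _ (fun m => hitting_time P pi [set m]%SET)).
Unshelve. all: by end_near.
Qed.
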